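(* Let $c:[0,\infty)\to[0,\infty)$ with $c(0)=0$ be such that $z(\phi)=c(\phi)/\phi$, $\phi>0$, is nonincreasing, and suppose $c$ induces an admissible transport cost $\tau$, i.e. $\tau(w)=\inf\{F^c[\psi]\mid\int_{\mathbb{R}}\psi\,dy=w\}$ for all $w\geq0$ with $\tau$ admissible. Then $$\int_0^1\sqrt{c(\phi)}\,d\phi<\infty,\qquad\text{which implies}\qquad\liminf_{\phi\searrow0}z(\phi)\phi^3=0.$$
   Context: A transport cost $\tau:[0,\infty)\to[0,\infty)$ is admissible if it is nondecreasing, concave and continuous with $\tau(0)=0$. For $c:[0,\infty)\to[0,\infty)$ and $\psi:\mathbb{R}\to\mathbb{R}$ (with locally integrable weak derivative; otherwise the energy is $+\infty$), $F^c[\psi]=\int_{\mathbb{R}}\frac12|\psi'(y)|^2+c(|\psi(y)|)\,dy$. *)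

(* Defs.v *)
From HB Require Import structures.
From mathcomp Require Import all_boot all_order all_algebra.
From mathcomp Require Import all_classical all_reals all_analysis.
Set Implicit Arguments. Unset Strict Implicit. Unset Printing Implicit Defensive.
Import Order.TTheory GRing.Theory Num.Def Num.Theory.
Import numFieldNormedType.Exports.
Local Open Scope classical_set_scope.
Local Open Scope ring_scope.

Section defs.
Variable R : realType.
Local Notation mu := (@lebesgue_measure R).

Definition test_function (phi : R -> R) : Prop :=
  (forall (n : nat) (x : R), derivable (derive1n n phi) x 1) /\
  exists M : R, forall x, M < `|x| -> phi x = 0.

Definition weak_derivative (psi g : R -> R) : Prop :=
  locally_integrable setT psi /\ locally_integrable setT g /\
  forall phi, test_function phi ->
    Rintegral mu setT (fun y => psi y * derive1 phi y) =
    - Rintegral mu setT (fun y => g y * phi y).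

(* F^c[psi] = int 1/2 |psi'|^2 + c(|psi|), and +oo if psi has no locally
   integrable weak derivative (inf over the empty set is +oo) *)
Definition energy (c : R -> R) (psi : R -> R) : \bar R :=
  ereal_inf [set (\int[mu]_y ((2^-1 * `|g y| ^+ 2 + c `|psi y|)%:E))%E
            | g in [set g | weak_derivative psi g]].

Definition induced_cost (c : R -> R) (w : R) : \bar R :=
  ereal_inf [set energy c psi | psi in
     [set psi | mu.-integrable setT (EFin \o psi) /\
                Rintegral mu setT psi = w]].

Definition admissible (tau : R -> R) : Prop :=
  [/\ forall w, 0 <= w -> 0 <= tau w,
      forall v w, 0 <= v -> v <= w -> tau v <= tau w,
      forall v w t, 0 <= v -> 0 <= w -> 0 <= t <= 1 ->
        t * tau v + (1 - t) * tau w <= tau (t * v + (1 - t) * w),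
      {within `[0, +oo[, continuous tau} &
      tau 0 = 0].
End defs.

(* Main.v *)
(** A competitor psi of finite energy and mass 1 has a continuous representative
    with psi t - psi s = int_[s, t] g; this follows by testing the weak derivative
    against smooth approximations of the indicator of [s, t] whose endpoints are
    Lebesgue points of psi.  Since psi is integrable and positive somewhere, it
    crosses every small level band ]u/2, u]; there c(psi) >= c(u)/2, and AM-GM
    bounds the energy spent in that band below by (u/2) sqrt (c u).  As c(x)/x is
    nonincreasing, this dominates the integral of sqrt c over ]u, 2u], and summing
    over the disjoint dyadic bands bounds the integral of sqrt c near 0 by the
    energy.  If the liminf were positive, sqrt c would dominate a multiple of 1/x
    near 0, contradicting int_0^x sqrt c -> 0. *)
Require Import Defs.
From HB Require Import structures.
From mathcomp Require Import all_boot all_order all_algebra.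
From mathcomp Require Import all_classical all_reals all_analysis.
From mathcomp Require Import measurable_realfun lra.
Set Implicit Arguments.
Unset Strict Implicit.
Unset Printing Implicit Defensive.
Import Order.TTheory GRing.Theory Num.Def Num.Theory.
Import numFieldNormedType.Exports.
Local Open Scope classical_set_scope.
Local Open Scope ring_scope.

(** * Calculus of smooth functions on the line *)

Section times_differentiable.
Context {R : realType}.
Implicit Types f g : R -> R.

(** Derivatives are carried as existential witnesses, so closure under products, inverses and affine
    substitutions goes by induction, without formulas for iterated derivatives. *)
Fixpoint times_differentiable n f : Prop :=
  if n is n'.+1 then
    exists2 f' : R -> R, (forall x : R, is_derive x 1 f (f' x)) & times_differentiable n' f'
  else True.

Definition smooth f := forall n, times_differentiable n f.

Lemma times_differentiableW n f :
  times_differentiable n.+1 f -> times_differentiable n f.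
Proof.
elim: n f => [//|n IH] f [f' df /IH f'n]; exists f' => //.
Qed.

Lemma times_differentiable_derive1n n f : times_differentiable n.+1 f ->
  forall x, derivable (derive1n n f) x 1.
Proof.
elim: n f => [|n IH] f [f' df f'n] x; first by have [] := df x.
rewrite derive1Sn (_ : f^`()%classic = f'); first exact: IH.
by apply/funext => y; rewrite derive1E; have [] := df y.
Qed.

Lemma smooth_derive1n f n x : smooth f -> derivable (derive1n n f) x 1.
Proof. by move=> /(_ n.+1)/times_differentiable_derive1n. Qed.

Lemma smooth_cst (a : R) : smooth (cst a).
Proof.
move=> n; elim: n a => [//|n IH] a.
by exists (cst 0) => [x|]; [exact: is_derive_cst|exact: IH].
Qed.

Lemma times_differentiableD n f g : times_differentiable n f ->
  times_differentiable n g -> times_differentiable n (f \+ g).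
Proof.
elim: n f g => [//|n IH] f g [f' df f'n] [g' dg g'n].
by exists (f' \+ g') => [x|]; [exact: is_deriveD|exact: IH].
Qed.

Lemma times_differentiableM n f g : times_differentiable n f ->
  times_differentiable n g -> times_differentiable n (f \* g).
Proof.
elim: n f g => [//|n IH] f g fn gn.
have [f' df f'n] := fn; have [g' dg g'n] := gn.
exists ((f \* g') \+ (g \* f')) => [x|].
  by apply: (is_derive_eq (is_deriveM (df x) (dg x))).
by apply: times_differentiableD; apply: IH => //; exact: times_differentiableW.
Qed.

Lemma smoothD f g : smooth f -> smooth g -> smooth (f \+ g).
Proof. by move=> sf sg n; exact: times_differentiableD. Qed.

Lemma smoothM f g : smooth f -> smooth g -> smooth (f \* g).
Proof. by move=> sf sg n; exact: times_differentiableM. Qed.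

Lemma smoothZ (a : R) f : smooth f -> smooth (fun x => a * f x).
Proof. by move=> sf; exact: smoothM (smooth_cst a) sf. Qed.

Lemma smoothB f g : smooth f -> smooth g -> smooth (f \- g).
Proof.
move=> sf sg; rewrite (_ : f \- g = f \+ (fun x => -1 * g x)).
  exact/smoothD/smoothZ.
by apply/funext => x /=; rewrite mulN1r.
Qed.

Lemma smoothV f : (forall x, f x != 0) -> smooth f ->
  smooth (fun x => (f x)^-1).
Proof.
move=> f0 sf; elim=> [//|n IH].
have [f' df f'n] := sf n.+1.
(* The derivative -f'/f^2 is written as a product in which 1/f itself reappears, so the induction
   hypothesis applies to it. *)
exists ((cst (-1) \* f') \* ((fun x => (f x)^-1) \* (fun x => (f x)^-1))) => [x|].
  apply: (is_derive_eq (is_deriveV (f0 x) (df x))).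
  by rewrite /= expr2 invfM /GRing.scale/=; lra.
apply: times_differentiableM; apply: times_differentiableM => //.
exact: smooth_cst.
Qed.

Lemma times_differentiable_affine n f (a b : R) : times_differentiable n f ->
  times_differentiable n (fun x => f (a * x + b)).
Proof.
elim: n f => [//|n IH] f [f' df f'n].
exists (cst a \* (fun x => f' (a * x + b))) => [x|]; last first.
  by apply: times_differentiableM; [exact: smooth_cst|exact: IH].
have dab : is_derive x 1 (fun x => a * x + b) a.
  have h := is_deriveD (is_deriveZ a (is_derive_id x 1)) (is_derive_cst b x 1).
  by apply: (is_derive_eq h); rewrite addr0 /GRing.scale/= mulr1.
rewrite /= mulrC -[X in is_derive _ _ X _]/(f \o (fun x => a * x + b)).
exact: is_derive1_comp.
Qed.

Lemma smooth_affine f (a b : R) : smooth f -> smooth (fun x => f (a * x + b)).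
Proof. by move=> sf n; exact: times_differentiable_affine. Qed.

Lemma smooth_derivable f x : smooth f -> derivable f x 1.
Proof. exact: (@smooth_derive1n f 0). Qed.

Lemma smooth_continuous f : smooth f -> continuous f.
Proof.
move=> sf x; apply/differentiable_continuous/derivable1_diffP.
exact: smooth_derivable.
Qed.

Lemma smooth_derive1 f : smooth f -> smooth f^`()%classic.
Proof.
move=> sf n; have [f' df f'n] := sf n.+1.
rewrite (_ : f^`()%classic = f')//.
by apply/funext => y; rewrite derive1E; have [] := df y.
Qed.

End times_differentiable.

(** * Flat functions p(1/x) exp(-1/x), extended by zero *)

Section flat_function.
Context {R : realType}.

(* The derivative of [p(1/x) exp(-1/x)] is again of this form, with the
   polynomial [X^2 (p - p')]; this closes the induction on the order. *)
Definition flat (p : {poly R}) (x : R) : R :=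
  if 0 < x then p.[x^-1] * expR (- x^-1) else 0.

Lemma flat_le0 p (x : R) : x <= 0 -> flat p x = 0.
Proof. by rewrite /flat; case: ltP. Qed.

(** The exponential series gives y^i exp(-y) <= i! for each monomial. *)
Lemma horner_expRN_bounded (p : {poly R}) :
  exists2 C, 0 <= C & forall y, 0 <= y -> `|p.[y] * expR (- y)| <= C.
Proof.
exists (\sum_(i < size p) `|p`_i| * i`!%:R).
  by apply: sumr_ge0 => i _; apply: mulr_ge0.
move=> y y0; rewrite horner_coef mulr_suml (le_trans (ler_norm_sum _ _ _))//.
apply: ler_sum => i _; rewrite -mulrA normrM ler_wpM2l//.
rewrite ger0_norm ?mulr_ge0 ?exprn_ge0 ?expR_ge0//.
rewrite expRN ler_pdivrMr ?expR_gt0//.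
case: (nat_of_ord i) => [|n].
  by rewrite expr0 fact0 mul1r (le_trans _ (expR_ge1Dx _))// lerDl.
rewrite mulrC -ler_pdivrMr ?ltr0n ?fact_gt0//.
by apply: (le_trans _ (expR_ge1Dxn n y0)); rewrite lerDr.
Qed.

(** The bound forces f(0) = 0, and the difference quotient at 0 is then squeezed between -C|h| and
    C|h|. *)
Lemma is_derive_quadratic0 (f : R -> R) (C : R) :
  (forall x, `|f x| <= C * x ^+ 2) -> is_derive (0:R) 1 f 0.
Proof.
move=> fC.
have f0 : f 0 = 0.
  by apply/eqP; rewrite -normr_le0 (le_trans (fC 0))// expr0n mulr0.
have cC : C * `|h| @[h --> (0:R)^'] --> (0:R).
  apply: cvg_within_filter.
  suff : C * `|h| @[h --> (0:R)] --> C * 0 by rewrite mulr0.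
  apply: cvgM; first exact: cvg_cst.
  by have := @norm_continuous _ R 0; rewrite /continuous_at normr0.
have H : h^-1 *: ((f \o shift 0) (h *: 1) - f 0) @[h --> (0:R)^'] --> (0:R).
  apply: (@squeeze_cvgr _ _ _ _ (fun h : R => - (C * `|h|)) (fun h : R => C * `|h|)).
  - near=> h; rewrite f0 subr0 /= addr0.
    have hn0 : h != 0 by near: h; exact: nbhs_dnbhs_neq.
    rewrite -ler_norml normrM normfV ler_pdivrMl ?normr_gt0//.
    rewrite (_ : h *: 1 = h); last by rewrite /GRing.scale/= mulr1.
    by rewrite (le_trans (fC h))// -real_normK ?num_real// expr2; lra.
  - have cCN : - (C * `|h|) @[h --> (0:R)^'] --> (- 0 : R) by exact: cvgN.
    by rewrite oppr0 in cCN.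
  - exact: cC.
apply: DeriveDef; first by apply/cvg_ex; exists 0.
by apply: cvg_lim.
Unshelve. all: by end_near. Qed.

Lemma is_derive_flat (p : {poly R}) (x : R) :
  is_derive x 1 (flat p) (flat ('X^2 * (p - p^`())) x).
Proof.
have [x0|x0|x0] := ltrgtP x 0.
- rewrite [X in is_derive _ _ _ X]flat_le0 ?ltW//.
  apply: (@near_eq_is_derive _ _ _ (cst 0)).
  near=> y; rewrite /flat; case: ltP => // y0; exfalso.
  have : y < 0 by near: y; exact: lt_nbhsl.
  by rewrite ltNge ltW.
- have dV : is_derive x 1 (fun y : R => y^-1) (- x ^- 2).
    apply: (is_derive_eq (is_deriveV _ (is_derive_id _ _))); first by rewrite gt_eqF.
    by rewrite /GRing.scale/= mulr1.
  have dp : is_derive x 1 (fun y => p.[y^-1]) (p^`().[x^-1] * - x ^- 2).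
    exact: (@is_derive1_comp _ (horner p)).
  have dN : is_derive x 1 (fun y : R => - y^-1) (x ^- 2).
    by apply: (is_derive_eq (is_deriveN dV)); rewrite opprK.
  have de : is_derive x 1 (fun y => expR (- y^-1)) (expR (- x^-1) * x ^- 2).
    exact: (@is_derive1_comp _ expR).
  have dpe := is_deriveM dp de.
  apply: (@near_eq_is_derive _ _ _ ((fun y => p.[y^-1]) * (fun y => expR (- y^-1)))).
    near=> y; rewrite /flat ifT//.
    by near: y; exact: lt_nbhsr.
  apply: (is_derive_eq dpe).
  rewrite /flat x0 hornerM hornerXn hornerD hornerN /GRing.scale/= exprVn; lra.
- rewrite x0 [X in is_derive _ _ _ X]flat_le0//.
  (* Bounding ['X^2 * p] at 1/y instead of [p] yields the factor y^2 that makes the derivative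
     vanish at the gluing point. *)
  have [C C0 pC] := horner_expRN_bounded ('X^2 * p).
  apply: (@is_derive_quadratic0 _ C) => y; rewrite /flat; case: ltP => y0.
    have := pC y^-1; rewrite hornerM hornerXn -mulrA normrM invr_ge0 => /(_ (ltW y0)).
    rewrite ger0_norm ?exprn_ge0 ?invr_ge0 ?(ltW y0)// exprVn ler_pdivrMl ?exprn_gt0//.
    by rewrite [_ * C]mulrC.
  by rewrite normr0 mulr_ge0 ?sqr_ge0.
Unshelve. all: by end_near. Qed.

Lemma smooth_flat (p : {poly R}) : smooth (flat p).
Proof.
move=> n; elim: n p => [//|n IH] p.
by exists (flat ('X^2 * (p - p^`()))) => [x|]; [exact: is_derive_flat|exact: IH].
Qed.

End flat_function.

(** * A smooth transition from 0 to 1 *)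

Section smooth_step.
Context {R : realType}.

(** The classical transition function built from exp(-1/x); 1 - x is spelled [- 1 * x + 1] to fit
    [smooth_affine]. *)
Definition smooth_step (x : R) : R :=
  flat 1 x / (flat 1 x + flat 1 (- 1 * x + 1)).

Lemma flat1_ge0 x : 0 <= flat 1 x :> R.
Proof. by rewrite /flat; case: ifP => // _; rewrite hornerC mul1r expR_ge0. Qed.

Lemma flat1_gt0 x : 0 < x -> 0 < flat 1 x :> R.
Proof. by move=> x0; rewrite /flat x0 hornerC mul1r expR_gt0. Qed.

(** At least one of x and 1 - x is positive. *)
Lemma smooth_step_den_gt0 x : 0 < flat 1 x + flat 1 (- 1 * x + 1) :> R.
Proof.
have [x0|x0] := ltP 0 x; first by rewrite ltr_wpDr ?flat1_ge0 ?flat1_gt0.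
by rewrite ltr_wpDl ?flat1_ge0// flat1_gt0//; lra.
Qed.

Lemma smooth_smooth_step : smooth smooth_step.
Proof.
apply: smoothM; first exact: smooth_flat.
apply: smoothV => [x|]; first by rewrite gt_eqF// smooth_step_den_gt0.
by apply: smoothD; [|apply: smooth_affine]; exact: smooth_flat.
Qed.

Lemma smooth_step_le0 x : x <= 0 -> smooth_step x = 0.
Proof. by move=> x0; rewrite /smooth_step flat_le0// mul0r. Qed.

Lemma smooth_step_ge1 x : 1 <= x -> smooth_step x = 1.
Proof.
move=> x1; rewrite /smooth_step [flat 1 (_ + _)]flat_le0; last by lra.
by rewrite addr0 divff// gt_eqF// flat1_gt0// (lt_le_trans _ x1).
Qed.

Lemma smooth_step_ge0_le1 x : 0 <= smooth_step x <= 1.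
Proof.
rewrite divr_ge0 ?flat1_ge0//=; last by rewrite ltW// smooth_step_den_gt0.
by rewrite ler_pdivrMr ?smooth_step_den_gt0// mul1r lerDl flat1_ge0.
Qed.

Lemma derive1_smooth_step_out (x : R) :
  x \notin `[0, 1] -> smooth_step^`()%classic x = 0.
Proof.
rewrite in_itv/= negb_and -!ltNge derive1E => /orP[x0|x1].
  rewrite (near_eq_derive (g := cst 0)) ?derive_cst//.
  near=> y; rewrite smooth_step_le0// ltW//.
  by near: y; exact: lt_nbhsl.
rewrite (near_eq_derive (g := cst (1 : R))) ?derive_cst//.
near=> y; rewrite smooth_step_ge1// ltW//.
by near: y; exact: lt_nbhsr.
Unshelve. all: by end_near. Qed.

Lemma derive1_smooth_step_bounded :
  exists2 C, 0 < C & forall x, `|smooth_step^`()%classic x| <= C.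
Proof.
have cS' : continuous (smooth_step^`()%classic : R -> R).
  exact/smooth_continuous/smooth_derive1/smooth_smooth_step.
have cN : {within `[0, 1], continuous (fun x => `|smooth_step^`()%classic x|)}.
  apply: continuous_subspaceT => x.
  exact: (continuous_comp (cS' x) (@norm_continuous _ _ _)).
have [c _ cmax] := EVT_max ler01 cN.
exists (`|smooth_step^`()%classic c| + 1); first by rewrite ltr_wpDl.
move=> x; rewrite ler_wpDr//; have [x01|] := boolP (x \in `[0, 1]).
  exact: cmax.
by move=> xN01; rewrite derive1_smooth_step_out// normr0.
Qed.

End smooth_step.

(** * Rescaled transitions and their derivatives *)

Section step_at.
Context {R : realType}.
Implicit Types (s e x : R).

(** The transition takes place on [s, s + e]; the argument (x - s)/e is kept in affine form for
    [smooth_affine]. *)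
Definition step_at s e x : R := smooth_step (e^-1 * x + - (s / e)).

Lemma smooth_step_at s e : smooth (step_at s e).
Proof. exact/smooth_affine/smooth_smooth_step. Qed.

Lemma step_at_argE s e x : e^-1 * x + - (s / e) = (x - s) / e.
Proof. by rewrite mulrBl mulrC. Qed.

Lemma step_at_le s e x : 0 < e -> x <= s -> step_at s e x = 0.
Proof.
move=> e0 xs; rewrite /step_at step_at_argE smooth_step_le0//.
by rewrite ler_pdivrMr// mul0r subr_le0.
Qed.

Lemma step_at_ge s e x : 0 < e -> s + e <= x -> step_at s e x = 1.
Proof.
move=> e0 xs; rewrite /step_at step_at_argE smooth_step_ge1//.
by rewrite ler_pdivlMr// mul1r; lra.
Qed.

Lemma step_at_ge0_le1 s e x : 0 <= step_at s e x <= 1.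
Proof. exact: smooth_step_ge0_le1. Qed.

Lemma derive1_step_at s e x :
  (step_at s e)^`()%classic x = e^-1 * smooth_step^`()%classic ((x - s) / e).
Proof.
have dl : is_derive x 1 (fun y => e^-1 * y + - (s / e)) e^-1.
  have h := is_deriveD (is_deriveZ e^-1 (is_derive_id x 1))
                       (is_derive_cst (- (s / e)) x 1).
  by apply: (is_derive_eq h); rewrite addr0 /GRing.scale/= mulr1.
rewrite -[step_at s e]/(smooth_step \o (fun y => e^-1 * y + - (s / e))).
rewrite derive1_comp; first last.
- exact/smooth_derivable/smooth_smooth_step.
- by case: dl.
by rewrite mulrC; congr (_ * _); [rewrite derive1E derive_val|rewrite step_at_argE].
Qed.

Lemma derive1_step_at_out s e x : 0 < e ->
  x \notin `[s, s + e] -> (step_at s e)^`()%classic x = 0.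
Proof.
move=> e0 xse; rewrite derive1_step_at derive1_smooth_step_out ?mulr0//.
apply: contra xse; rewrite !in_itv/= ler_pdivlMr// ler_pdivrMr// mul0r mul1r.
by rewrite subr_ge0 lerBlDl.
Qed.

Lemma continuous_derive1_step_at s e : continuous (step_at s e)^`()%classic.
Proof. exact/smooth_continuous/smooth_derive1/smooth_step_at. Qed.

(** The constant is uniform in s and e, so that C/e is compensated by the length of the transition
    window. *)
Lemma derive1_step_at_bounded : exists2 C, 0 < C & forall s e x,
  0 < e -> `|(step_at s e)^`()%classic x| <= C / e.
Proof.
have [C C0 SC] := @derive1_smooth_step_bounded R.
exists C => // s e x e0.
by rewrite derive1_step_at normrM gtr0_norm ?invr_gt0// mulrC ler_wpM2r// invr_ge0 ltW.
Qed.

End step_at.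

(** * Integrals of bounded multiples and of restrictions *)

Section integral_lemmas.
Context {R : realType}.
Local Notation mu := (@lebesgue_measure R).
Implicit Types (f k : R -> R) (A D : set R).

Lemma locally_integrable_itv f (a b : R) : locally_integrable setT f ->
  mu.-integrable `[a, b] (EFin \o f).
Proof.
move=> [mf _ intf]; apply/integrableP; split.
  by apply/measurable_EFinP; exact: measurable_funTS.
by apply: intf => //; exact: segment_compact.
Qed.

Lemma integrable_mul_bounded D f k (C : R) : measurable D ->
  mu.-integrable D (EFin \o f) -> measurable_fun D k ->
  (forall x, D x -> `|k x| <= C) ->
  mu.-integrable D (EFin \o (fun x => f x * k x)).
Proof.
move=> mD intf mk kC.
have bk : [bounded k x | x in D].
  exists C; split; first exact: num_real.
  by move=> M CM x Dx; exact: le_trans (kC x Dx) (ltW CM).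
exact: (@integrableMl _ _ _ mu D mD _ _ intf mk bk).
Qed.

Lemma Rintegral_vanish A D f : A `<=` D -> (forall x, ~ A x -> f x = 0) ->
  (\int[mu]_(x in D) f x = \int[mu]_(x in A) f x)%R.
Proof.
move=> AD f0; rewrite -[in RHS](setIidr AD) Rintegral_mkcondr.
congr Rintegral; apply/funext => x; rewrite patchE; case: ifPn => // /negP xA.
by rewrite f0// => Ax; apply: xA; rewrite inE.
Qed.

Lemma Rintegral_mul_indic A D f : A `<=` D ->
  (\int[mu]_(x in D) (f x * \1_A x) = \int[mu]_(x in A) f x)%R.
Proof.
move=> AD; rewrite -[in RHS](setIidr AD) Rintegral_mkcondr.
congr Rintegral; apply/funext => x; rewrite patchE indicE.
by case: ifPn => _; rewrite ?mulr1 ?mulr0.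
Qed.

End integral_lemmas.

(** * Mollification by the derivative of a transition *)

Section du_bois_reymond.
Context {R : realType}.
Local Notation mu := (@lebesgue_measure R).
Implicit Types (psi g : R -> R) (s t e a b : R).

Lemma integral_derive1_step_at s e : 0 < e ->
  (\int[mu]_(y in `[s, (s + e)%R]) (step_at s e)^`()%classic y = 1)%R.
Proof.
move=> e0; rewrite /Rintegral (@continuous_FTC2 _ _ (step_at s e)).
- by rewrite step_at_ge// step_at_le//= subr0.
- by rewrite ltrDl.
- exact/continuous_subspaceT/continuous_derive1_step_at.
- have cS := smooth_continuous (smooth_step_at s e).
  split.
  + by move=> x _; exact/smooth_derivable/smooth_step_at.
  + exact/cvg_at_right_filter/cS.
  + exact/cvg_at_left_filter/cS.
- by [].
Qed.

(** The kernel has unit mass on [s, s + e/2] and size at most 2C/e. This window lies in the open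
    ball of radius e, of length 2e, and 2C/e = 4C/(2e). *)
Lemma mollify_step_at psi s a b e (C : R) :
  locally_integrable setT psi -> 0 < e -> a <= s -> s + e / 2 <= b ->
  (forall s e x, 0 < e -> `|(step_at s e)^`()%classic x| <= C / e) ->
  (`|\int[mu]_(y in `[a, b]) (psi y * (step_at s (e / 2))^`()%classic y) -
     psi s|%:E <= (4 * C)%:E * davg psi s e)%E.
Proof.
move=> lpsi e0 as_ sb kC; set w := e / 2; have w0 : 0 < w by rewrite divr_gt0.
set k := (step_at s w)^`()%classic.
have C0 : 0 <= C.
  have := le_trans (normr_ge0 _) (kC s 1 s ltr01).
  by rewrite divr1.
have mk D : measurable_fun D k.
  apply: measurable_funTS; apply: continuous_measurable_fun.
  exact: continuous_derive1_step_at.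
have kout x : ~ `[s, (s + w)%R]%classic x -> k x = 0.
  by move=> /negP xs; exact: derive1_step_at_out.
have ipsi : mu.-integrable `[s, (s + w)] (EFin \o psi).
  exact: locally_integrable_itv.
have icst : mu.-integrable `[s, (s + w)] (EFin \o cst (psi s)).
  apply: continuous_compact_integrable; first exact: segment_compact.
  exact/continuous_subspaceT/cst_continuous.
have mI : measurable (`[s, (s + w)]%classic : set R) by [].
have kb x : `[s, (s + w)]%classic x -> `|k x| <= C / w by move=> _; exact: kC.
rewrite (@Rintegral_vanish _ `[s, (s + w)]); last 2 first.
- by apply: subset_itv; rewrite bnd_simp.
- by move=> x /kout ->; rewrite mulr0.
(* Unit mass turns the constant into an integral over the same window. *)
have -> : psi s = (\int[mu]_(y in `[s, (s + w)%R]) (psi s * k y))%R.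
  rewrite RintegralZl ?integral_derive1_step_at ?mulr1//.
  apply: continuous_compact_integrable; first exact: segment_compact.
  exact/continuous_subspaceT/continuous_derive1_step_at.
rewrite -RintegralB//; last 2 first.
- exact: integrable_mul_bounded kb.
- exact: (integrable_mul_bounded _ icst _ kb).
have idiff : mu.-integrable `[s, (s + w)] (EFin \o (fun y => psi y - psi s)).
  by apply: (integrableB _ ipsi icst).
have idk := integrable_mul_bounded mI idiff (mk _) kb.
have -> : (\int[mu]_(x in `[s, (s + w)%R]) (psi x * k x - psi s * k x) =
          \int[mu]_(x in `[s, (s + w)%R]) ((psi x - psi s) * k x))%R.
  by apply: eq_Rintegral => x _; rewrite mulrBl.
rewrite EFin_normr_Rintegral//.
apply: (le_trans (le_abse_integral _ _ _)) => //.
  by case/integrableP : idk.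
have mdiff D : measurable_fun D (fun x => psi x - psi s).
  apply: measurable_funTS; apply: measurable_funB => //; by case: lpsi.
apply: (@le_trans _ _ (\int[mu]_(x in `[s, (s + w)%R]) ((C / w)%:E * `|(psi x - psi s)%:E|)))%E.
  apply: ge0_le_integral => //.
  - by apply: measurableT_comp => //; case/integrableP : idk.
  - apply/measurable_EFinP; apply: measurable_funM => //.
    exact: (measurableT_comp _ (mdiff _)).
  - move=> x xI; rewrite /= -EFinM lee_fin normrM mulrC ler_wpM2r//.
    exact: kb.
rewrite ge0_integralZl//; last 2 first.
- by apply/measurable_EFinP; exact: (measurableT_comp _ (mdiff _)).
- by rewrite lee_fin divr_ge0// ltW.
rewrite /davg /iavg (lebesgue_measure_ball _ (ltW e0)) inver mulrn_eq0/= gt_eqF//.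
rewrite muleA -EFinM (_ : 4 * C * _ = C / w); last first.
  by rewrite /w invf_div -[e *+ 2]mulr_natr invfM; lra.
apply: lee_wpmul2l; first by rewrite lee_fin divr_ge0// ltW.
apply: ge0_subset_integral => //.
- exact: measurable_ball.
- by apply/measurable_EFinP; exact: (measurableT_comp _ (mdiff _)).
- rewrite ball_itv; apply: subset_itv; rewrite bnd_simp.
    by rewrite ltrBlDr ltrDl.
  by rewrite ltrD2l /w ltr_pdivrMr// ltr_pMr// ltr1n.
Qed.

End du_bois_reymond.

(** * Increments between Lebesgue points as integrals of the weak derivative *)

Section du_bois_reymond_lebesgue_pt.
Context {R : realType}.
Local Notation mu := (@lebesgue_measure R).
Implicit Types (psi g : R -> R) (s t e w : R).

(** Pointwise on [s, t + w], the smoothed indicator differs from that of [s, t] by at most the sum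
    of the indicators of the two transition windows. *)
Lemma step_at_window g s t w : locally_integrable setT g -> 0 < w -> s <= t ->
  `|\int[mu]_(y in `[s, (t + w)]) (g y * (step_at s w y - step_at t w y)) -
    \int[mu]_(y in `[s, t]) g y| <=
  \int[mu]_(y in `[s, (s + w)]) `|g y| + \int[mu]_(y in `[t, (t + w)]) `|g y|.
Proof.
move=> lg w0 st; set D := `[s, t + w]%classic.
have mD : measurable (D : set R) by exact: measurable_itv.
have ig : mu.-integrable D (EFin \o g) by exact: locally_integrable_itv.
have iga : mu.-integrable D (EFin \o (fun x => `|g x|)) by exact: integrable_norm.
have indb A x : `|\1_A x| <= 1 :> R by rewrite indicE ger0_norm// lern1 leq_b1.
have mi (A : set R) : measurable A -> measurable_fun D (\1_A : R -> R).
  by move=> mA; exact: measurable_indic.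
have sub1 : `[s, t]%classic `<=` D by apply: subset_itv; rewrite bnd_simp// lerDl ltW.
have sub2 : `[s, s + w]%classic `<=` D by apply: subset_itv; rewrite bnd_simp// lerD2r.
have sub3 : `[t, t + w]%classic `<=` D by apply: subset_itv; rewrite bnd_simp.
rewrite -(Rintegral_mul_indic _ sub1) -(Rintegral_mul_indic _ sub2).
rewrite -(Rintegral_mul_indic _ sub3).
have mstep r : measurable_fun D (step_at r w).
  apply: measurable_funTS; apply: continuous_measurable_fun.
  exact/smooth_continuous/smooth_step_at.
have stepb r x : `|step_at r w x| <= 1.
  by have /andP[? ?] := step_at_ge0_le1 r w x; rewrite ger0_norm.
have i1 : mu.-integrable D (EFin \o (fun y => g y * (step_at s w y - step_at t w y))).
  apply: (@integrable_mul_bounded _ _ _ _ 2) => //; first exact: measurable_funB.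
  by move=> x _; rewrite (le_trans (ler_normB _ _))// (natrD _ 1 1) lerD.
have i2 (A : set R) : measurable A ->
    mu.-integrable D (EFin \o (fun y => g y * \1_A y)).
  by move=> mA; apply: (@integrable_mul_bounded _ _ _ _ 1) => //; exact: mi.
have i3 (A : set R) : measurable A ->
    mu.-integrable D (EFin \o (fun y => `|g y| * \1_A y)).
  by move=> mA; apply: (@integrable_mul_bounded _ _ (fun y => `|g y|) _ 1) => //; exact: mi.
rewrite -RintegralB//; last exact: i2.
rewrite -RintegralD//; [|exact: i3..].
apply: le_trans.
  apply: le_normr_Rintegral => //.
  by apply: (integrableB _ i1 (i2 _ _)).
apply: le_Rintegral => //.
- by apply: integrable_norm; apply: (integrableB _ i1 (i2 _ _)).
- by apply: (integrableD _ (i3 _ _) (i3 _ _)).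
move=> x; rewrite /D/= in_itv/= => /andP[sx xtw].
rewrite -mulrBr -mulrDr normrM ler_wpM2l//.
rewrite !indicE !mem_setE !in_itv/= sx xtw/= andbT.
have /andP[? ?] := step_at_ge0_le1 s w x.
have /andP[? ?] := step_at_ge0_le1 t w x.
(* Up to t only the left transition can be incomplete; beyond t the second window already
   contributes 1, even if the windows overlap. *)
have [xt|tx] := leP x t.
  rewrite (step_at_le (s := t))//; have [xsw|swx] := leP x (s + w).
    by rewrite ler_norml; case: (t <= x) => /=; lra.
  by rewrite (step_at_ge w0 (ltW swx)) ler_norml; case: (t <= x) => /=; lra.
by rewrite (ltW tx) ler_norml; case: (x <= s + w) => /=; lra.
Qed.

(** Both transitions are 0 far to the left and 1 far to the right, so their difference has bounded
    support. *)
Lemma test_function_step_at s t w : 0 < w ->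
  test_function (step_at s w \- step_at t w).
Proof.
move=> w0; split.
  by move=> n x; apply: smooth_derive1n; apply: smoothB; exact: smooth_step_at.
exists (`|s| + `|t| + w) => x; rewrite lter_normr/= => /orP[] xM /=.
  have := ler_norm s; have := ler_norm t => ? ?.
  have := normr_ge0 s; have := normr_ge0 t => ? ?.
  by rewrite !step_at_ge ?subrr//; lra.
have := ler_norm (- s); have := ler_norm (- t); rewrite !normrN => ? ?.
have := normr_ge0 s; have := normr_ge0 t => ? ?.
by rewrite !step_at_le ?subrr//; lra.
Qed.

Lemma davg_small psi s (C eta : R) : 0 < C -> 0 < eta -> lebesgue_pt psi s ->
  \forall e \near 0^'+, (C%:E * davg psi s e <= eta%:E)%E.
Proof.
move=> C0 eta0 ls.
have : \forall e \near 0^'+, (davg psi s e < (eta / C)%:E)%E.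
  apply: (ls [set x | x < (eta / C)%:E]%E).
  rewrite /nbhs/=/ereal_nbhs/=; near=> r; rewrite lte_fin.
  by near: r; apply: lt_nbhsl; rewrite divr_gt0.
apply: filterS => e /ltW h; rewrite -lee_pdivlMl// -EFinM mulrC.
exact: h.
Unshelve. all: by end_near. Qed.

Lemma integral_norm_small g s (eta : R) : locally_integrable setT g -> 0 < eta ->
  \forall e \near 0^'+, \int[mu]_(y in `[s, (s + e / 2)]) `|g y| <= eta.
Proof.
move=> lg eta0.
have ig : mu.-integrable `[s, s + 1] (EFin \o (fun x => `|g x|)).
  exact/integrable_norm/locally_integrable_itv.
have s1 : s < s + 1 by rewrite ltrDl.
have /nbhs_ballP[d /= d0 sd] := parameterized_integral_near_left s1 eta0 ig.
near=> e.
have e0 : 0 < e by near: e; exact: nbhs_right_gt.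
have ed : e < d by near: e; exact: nbhs_right_lt.
apply: le_trans (ler_norm _) _; apply/ltW/sd; last by rewrite lerDl divr_ge0// ltW.
by rewrite ball_itv/= in_itv/=; apply/andP; split; lra.
Unshelve. all: by end_near. Qed.

(* Testing against a smooth approximation of the indicator of [s, t]. *)
Lemma weak_derivative_lebesgue_pt psi g s t : weak_derivative psi g -> s <= t ->
  lebesgue_pt psi s -> lebesgue_pt psi t ->
  psi t - psi s = \int[mu]_(y in `[s, t]) g y.
Proof.
move=> [lpsi [lg psig]] st ls lt; apply/eqP; rewrite -subr_eq0 -normr_le0.
(* Error budget: eta for each endpoint value and 2 eta for the two windows, whence
   [eta := eps / 4]. *)
have arith (As At B I ps pt eta : R) : `|As - ps| <= eta -> `|At - pt| <= eta ->
    `|B - I| <= eta + eta -> As - At = - B -> `|pt - ps - I| <= eta * 4.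
  rewrite !ler_norml => /andP[? ?] /andP[? ?] /andP[? ?] ?.
  by apply/andP; split; lra.
have [C C0 SC] := @derive1_step_at_bounded R.
apply/ler_addgt0Pr => eps eps0; rewrite add0r.
set eta := eps / 4; have eta0 : 0 < eta by rewrite divr_gt0.
have C40 : 0 < 4 * C by rewrite mulr_gt0.
near (0:R)^'+ => e.
have e0 : 0 < e by near: e; exact: nbhs_right_gt.
pose w := e / 2; have w0 : 0 < w by rewrite divr_gt0.
set D := `[s, t + w]%classic.
pose ds := (step_at s w)^`()%classic; pose dt := (step_at t w)^`()%classic.
have dout r x : s <= r <= t -> ~ D x -> (step_at r w)^`()%classic x = 0.
  move=> rst /negP xD; rewrite derive1_step_at_out//; move: xD.
  rewrite /D/= !in_itv/= !negb_and -!ltNge => /orP[?|?]; apply/orP; [left|right]; lra.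
have phiout x : ~ D x -> step_at s w x - step_at t w x = 0.
  move=> /negP; rewrite /D/= in_itv/= negb_and -!ltNge => /orP[xD|xD].
    by rewrite !step_at_le ?subrr//; lra.
  by rewrite !step_at_ge ?subrr//; lra.
have As : `|\int[mu]_(y in D) (psi y * ds y) - psi s| <= eta.
  rewrite -lee_fin; apply: le_trans.
    by apply: (mollify_step_at (a := s) lpsi e0 _ _ SC); rewrite // lerD2r.
  by near: e; exact: davg_small.
have At : `|\int[mu]_(y in D) (psi y * dt y) - psi t| <= eta.
  rewrite -lee_fin; apply: le_trans.
    by apply: (mollify_step_at (a := s) lpsi e0 _ _ SC).
  by near: e; exact: davg_small.
have B := step_at_window lg w0 st.
have B1 : \int[mu]_(y in `[s, (s + e / 2)]) `|g y| <= eta.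
  by near: e; exact: integral_norm_small.
have B2 : \int[mu]_(y in `[t, (t + e / 2)]) `|g y| <= eta.
  by near: e; exact: integral_norm_small.
have mD : measurable (D : set R) by exact: measurable_itv.
have ipsi : mu.-integrable D (EFin \o psi) by exact: locally_integrable_itv.
have i r : mu.-integrable D (EFin \o (fun y => psi y * (step_at r w)^`()%classic y)).
  apply: (@integrable_mul_bounded _ _ _ _ (C / w)) => //.
    apply: measurable_funTS; apply: continuous_measurable_fun.
    exact: continuous_derive1_step_at.
  by move=> x _; exact: SC.
(* The derivative of the test function is the difference of the mollifiers at s and t, so the weak
   equation relates the averages of psi at both ends to the smoothed integral of g. *)
have := psig _ (test_function_step_at s t w0).
rewrite (_ : (step_at s w \- step_at t w)^`()%classic = ds \- dt); last first.
  apply/funext => x.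
  have dS r : derivable (step_at r w) x 1 by exact/smooth_derivable/smooth_step_at.
  by rewrite /ds /dt /= !derive1E (deriveB (dS s) (dS t)).
rewrite (@Rintegral_vanish _ D)//; last first.
  by move=> x xD; rewrite /= /ds /dt (dout s) ?(dout t) ?subrr ?mulr0 ?lexx ?st.
rewrite (@Rintegral_vanish _ D setT)//; last first.
  by move=> x xD; rewrite /= phiout// mulr0.
rewrite (_ : \int[mu]_(x in D) (psi x * (ds \- dt) x) =
    \int[mu]_(x in D) (psi x * ds x) - \int[mu]_(x in D) (psi x * dt x)); last first.
  rewrite -(@RintegralB _ _ _ mu D _ _ mD (i s) (i t)).
  by apply: eq_Rintegral => x _; rewrite -mulrBr.
move=> E; have -> : eps = eta * 4 by rewrite divfK.
exact: arith As At (le_trans B (lerD B1 B2)) E.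
Unshelve. all: by end_near. Qed.

End du_bois_reymond_lebesgue_pt.

(** * The continuous representative *)

Section continuous_representative.
Context {R : realType}.
Local Notation mu := (@lebesgue_measure R).
Implicit Types (psi g : R -> R) (a b c : R).

Lemma Rintegral_itv_chasles g a b c : locally_integrable setT g ->
  a <= b -> b <= c ->
  \int[mu]_(y in `[a, c]) g y =
  \int[mu]_(y in `[a, b]) g y + \int[mu]_(y in `[b, c]) g y.
Proof.
move=> lg ab bc; apply/eqP; rewrite addrC -subr_eq; apply/eqP.
rewrite Rintegral_itvB ?bnd_simp//; last exact: locally_integrable_itv.
rewrite Rintegral_itv_obnd_cbnd//.
apply: (@integrableS _ _ _ mu `[b, c]) => //.
  by apply: subset_itv; rewrite bnd_simp.
exact: locally_integrable_itv.
Qed.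

(** Otherwise a null set would contain [0, 1]. *)
Lemma ae_ex (P : R -> Prop) : {ae mu, forall x, P x} -> exists x, P x.
Proof.
move=> [N [mN N0 PN]]; apply: contrapT => nP.
have : (mu (`[0%R, 1%R]%classic : set R) <= mu N)%E.
  apply: le_measure; rewrite ?inE//.
  by move=> x _; apply: PN => Px; apply: nP; exists x.
rewrite [mu N]N0.
by rewrite lebesgue_measure_itv/= lte_fin ltr01 oppr0 adde0 lee_fin ler10.
Qed.

(** The primitive of g is anchored at one Lebesgue point [s0] of psi; it agrees with psi at every
    other Lebesgue point, hence almost everywhere. *)
Lemma weak_derivative_continuous_representative psi g : weak_derivative psi g ->
  exists Psi : R -> R, [/\ continuous Psi, {ae mu, forall x, psi x = Psi x} &
    forall s t, s <= t -> Psi t - Psi s = \int[mu]_(y in `[s, t]) g y].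
Proof.
move=> wd; have [lpsi [lg _]] := wd.
have [s0 ls0] := ae_ex (lebesgue_differentiation lpsi).
pose I a b := \int[mu]_(y in `[a, b]) g y.
(* Integrals over intervals are unoriented, so the sign is chosen by cases. *)
pose Psi x := psi s0 + (if s0 <= x then I s0 x else - I x s0).
have PsiB s t : s <= t -> Psi t - Psi s = I s t.
  move=> st; rewrite /Psi opprD addrACA subrr add0r.
  have chI x y z : x <= y -> y <= z -> I x z = I x y + I y z.
    exact: Rintegral_itv_chasles.
  have [s0t|ts0] := leP s0 t; have [s0s|ss0] := leP s0 s.
  - by rewrite (chI s0 s t)// addrAC subrr add0r.
  - by rewrite (chI s s0 t) ?(ltW ss0)// opprK addrC.
  - by have := lt_le_trans ts0 (le_trans s0s st); rewrite ltxx.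
  - by rewrite (chI s t s0) ?(ltW ts0)// opprK addrC addrK.
exists Psi; split=> //.
- move=> x.
  (* Continuity is local: near x, [Psi] is a constant plus the integral of g from x - 1. *)
  have x1 : x - 1 < x + 1 by rewrite ltrD2l gtrN.
  have ig : mu.-integrable `[x - 1, x + 1] (EFin \o g) by exact: locally_integrable_itv.
  have cI := parameterized_integral_continuous (ltW x1) ig.
  have /(continuous_within_itvP _ x1)[/(_ x) cx _ _] := cI.
  have {}cx : {for x, continuous (fun y => I (x - 1) y)}.
    by apply: cx; rewrite in_itv/= ltrBlDr !ltrDl ltr01.
  have cP : {for x, continuous (fun y => Psi (x - 1) + I (x - 1) y)}.
    by apply: cvgD; [exact: cvg_cst|exact: cx].
  apply: cvg_trans; last first.
    rewrite -[Psi x](subrKC (Psi (x - 1))) PsiB; last by rewrite gerBl.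
    exact: cP.
  apply: near_eq_cvg; near=> y; rewrite -PsiB ?subrKC//.
  by apply: ltW; near: y; apply: lt_nbhsr; rewrite ltrBlDr ltrDl.
- have [N [mN N0 lN]] := lebesgue_differentiation lpsi.
  exists N; split=> // x /= nx; apply: lN => /= lx; apply: nx.
  rewrite /Psi; case: leP => [s0x|xs0].
    by rewrite /I -(weak_derivative_lebesgue_pt wd s0x ls0 lx) subrKC.
  by rewrite /I -(weak_derivative_lebesgue_pt wd (ltW xs0) lx ls0) opprB subrKC.
Unshelve. all: by end_near. Qed.

End continuous_representative.

(** * Level crossings of a continuous function *)

Section crossing.
Context {R : realType}.
Implicit Types (f : R -> R) (s t u v : R).

(** Take a to be the maximum of the compact set of points of [s, t] where f is at least u. *)
Lemma last_above f s t u : continuous f -> s <= t -> u <= f s ->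
  exists a, [/\ s <= a <= t, u <= f a & forall x, a < x <= t -> f x < u].
Proof.
move=> cf st us; pose A := `[s, t]%classic `&` f @^-1` [set x | u <= x].
have cA : compact A.
  apply: compact_closedI; first exact: segment_compact.
  by apply: preimage_closed => // x _; exact: cf.
have A0 : A !=set0 by exists s; split => //=; rewrite in_itv/= lexx.
have cid : {within A, continuous (id : R -> R)}.
  by apply: continuous_subspaceT => x; exact: cvg_id.
have [a] := compact_EVT_max A0 cA cid.
rewrite inE => -[]; rewrite /= in_itv/= => sat ua amax.
exists a; split=> // x /andP[ax xt]; rewrite ltNge; apply/negP => ux.
have := amax x; rewrite leNgt ax => /(_ _)/negP; apply => //.
rewrite inE; split => //=; rewrite in_itv/= xt andbT.
by case/andP : sat => sa _; exact: le_trans sa (ltW ax).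
Qed.

(** Reflection: [last_above] applied to -f(-x). *)
Lemma first_below f s t v : continuous f -> s <= t -> f t <= v ->
  exists b, [/\ s <= b <= t, f b <= v & forall x, s <= x < b -> v < f x].
Proof.
move=> cf st tv.
have cfN : continuous (fun x => - f (- x)).
  move=> x; apply: cvgN; apply: (@continuous_comp _ _ _ (-%R) f).
    exact: opp_continuous.
  exact: cf.
have [||b [/andP[tb bs] vb bx]] := @last_above _ (- t) (- s) (- v) cfN.
- by rewrite lerN2.
- by rewrite opprK lerN2.
exists (- b); split.
- by apply/andP; split; [rewrite lerNr|rewrite lerNl].
- by rewrite -lerN2.
- move=> x /andP[sx xb]; rewrite -ltrN2 -[x]opprK; apply: bx.
  by rewrite ltrNr xb/= lerN2.
Qed.

(** First a is the last point of [s, t] above u, then b the first point after a below v; in between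
    f avoids both sides of the band. *)
Lemma crossing f s t u v : continuous f -> s <= t -> v < u ->
  u <= f s -> f t <= v ->
  exists a b, [/\ a <= b, u <= f a, f b <= v &
    forall x, a < x < b -> v < f x < u].
Proof.
move=> cf st vu us tv.
have [a [/andP[sa at_] ua aout]] := last_above cf st us.
have [b [/andP[ab bt] bv bout]] := first_below cf at_ tv.
exists a, b; split => // x /andP[ax xb].
rewrite bout ?(ltW ax)//=.
by rewrite aout// ax (le_trans (ltW xb)).
Qed.

End crossing.

(** * Dyadic decomposition of ]0, u] *)

Section dyadic.
Context {R : realType}.
Implicit Types u x : R.

Definition dyadic u k : set R := `]u / 2 ^+ k.+1, u / 2 ^+ k]%classic.

Lemma dyadic_le u i j : 0 <= u -> (i <= j)%N -> u / 2 ^+ j <= u / 2 ^+ i.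
Proof.
by move=> u0 ij; rewrite ler_wpM2l// lef_pV2 ?posrE ?exprn_gt0// ler_weXn2l ?ler1n.
Qed.

Lemma trivIset_dyadic u : 0 <= u -> trivIset setT (dyadic u).
Proof.
move=> u0; apply: ltn_trivIset => j i ij; rewrite -subset0 => x /= [].
rewrite /dyadic/= !in_itv/= => /andP[xi _] /andP[_ xj].
have := lt_le_trans xi xj; rewrite ltNge; apply/negP; rewrite negbK.
exact: dyadic_le.
Qed.

Lemma bigcup_dyadic u : 0 < u -> \bigcup_k dyadic u k = `]0, u]%classic.
Proof.
move=> u0; apply/seteqP; split=> x /=.
  move=> [k _]; rewrite /dyadic/= !in_itv/= => /andP[kx xk].
  rewrite (lt_trans _ kx) ?divr_gt0 ?exprn_gt0//= (le_trans xk)//.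
  by have := dyadic_le (ltW u0) (leq0n k); rewrite expr0 divr1.
rewrite in_itv/= => /andP[x0 xu].
have ex : exists n, u / 2 ^+ n < x.
  exists (Num.bound (u / x)).
  rewrite ltr_pdivrMr ?exprn_gt0// mulrC -ltr_pdivrMr//.
  rewrite (lt_trans (archi_boundP _)) ?divr_ge0 ?(ltW x0) ?(ltW u0)//.
  by rewrite -natrX ltr_nat ltn_expl.
(* The least exponent with u/2^n < x is nonzero because x <= u; its predecessor is the index of the
   band containing x. *)
have [[|n] nx nmin] := ex_minnP ex.
  by move: nx; rewrite expr0 divr1 ltNge xu.
exists n => //; rewrite /dyadic/= in_itv/= nx/= leNgt; apply/negP => /nmin.
by rewrite ltnn.
Qed.

End dyadic.

(** * Costs with nonincreasing slope *)

Section cost.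
Context {R : realType}.
Local Notation mu := (@lebesgue_measure R).
Variable c : R -> R.
Hypothesis c_ge0 : forall x, 0 <= x -> 0 <= c x.
Hypothesis c0 : c 0 = 0.
Hypothesis c_slope : forall x y, 0 < x -> x <= y -> c y / y <= c x / x.

Lemma cost_le_scaled x y : 0 < x -> x <= y -> c y <= c x / x * y.
Proof.
move=> x0 xy; have y0 := lt_le_trans x0 xy.
by rewrite -ler_pdivrMr// c_slope.
Qed.

Lemma cost_ge_scaled x y : 0 < x -> x <= y -> c y / y * x <= c x.
Proof. by move=> x0 xy; rewrite -ler_pdivlMr// c_slope. Qed.

(** By monotonicity, superlevel sets of the slope are intervals. *)
Lemma measurable_slope :
  measurable_fun (`]0, +oo[%classic : set R) (fun x => c x / x).
Proof.
apply: (measurability _ (RGenOInfty.measurableE R)) => _ [_ [y ->] <-].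
 apply: is_interval_measurable => a b /=.
rewrite !in_itv/= !andbT => -[a0 ya] [b0 yb] x /andP[ax xb].
have x0 := lt_le_trans a0 ax.
by split; rewrite /= in_itv/= andbT//; exact: lt_le_trans yb (c_slope x0 xb).
Qed.

(** On ]0, +oo[, c is its slope times the identity; since c(0) = 0, the function is the extension of
    this by zero, composed with the absolute value. *)
Lemma measurable_cost_norm : measurable_fun setT (fun x : R => c `|x|).
Proof.
have mD : measurable (`]0, +oo[%classic : set R) by exact: measurable_itv.
have mc : measurable_fun (`]0, +oo[%classic : set R) c.
  apply: (@eq_measurable_fun _ _ _ _ _ (fun x => c x / x * x)).
    by move=> x; rewrite inE/= in_itv/= andbT => x0; rewrite divfK ?gt_eqF.
  by apply: measurable_funM; [exact: measurable_slope|exact: measurable_id].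
have mcD := (measurable_restrictT _ mD).1 mc.
rewrite (_ : (fun x => _) = (c \_ `]0, +oo[) \o normr); last first.
  apply/funext => x /=; rewrite patchE mem_setE in_itv/= andbT.
  by case: (ltgtP 0 `|x|) => // [|<-//]; rewrite ltNge normr_ge0.
exact: measurableT_comp.
Qed.

Lemma measurable_sqrt_cost (D : set R) : D `<=` [set x | 0 <= x] ->
  measurable_fun D (fun x => (Num.sqrt (c x))%:E).
Proof.
move=> D0; apply/measurable_EFinP.
apply: (@eq_measurable_fun _ _ _ _ D (Num.sqrt \o (fun x => c `|x|))).
  by move=> x; rewrite inE => /D0 /= x0; rewrite ger0_norm.
apply: measurable_funTS; apply: measurableT_comp measurable_cost_norm.
by apply: continuous_measurable_fun; exact: sqrt_continuous.
Qed.

(** * Energy of a continuous profile against the integral of sqrt c *)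

Section profile.
Variables psi g : R -> R.
Hypothesis cpsi : continuous psi.
Hypothesis lg : locally_integrable setT g.
Hypothesis psiB :
  forall s t, s <= t -> psi t - psi s = \int[mu]_(y in `[s, t]) g y.

Let density y := 2^-1 * `|g y| ^+ 2 + c `|psi y|.

Lemma density_ge0 y : 0 <= density y.
Proof. by rewrite addr_ge0 ?c_ge0// mulr_ge0 ?exprn_ge0 ?invr_ge0. Qed.

Lemma measurable_density : measurable_fun setT density.
Proof.
apply: measurable_funD.
  apply: measurable_funM => //; apply: measurable_funX.
  by apply: measurableT_comp => //; case: lg.
apply: (measurableT_comp measurable_cost_norm).
exact: continuous_measurable_fun.
Qed.

(* Between its last visit above u and its next visit below u/2, the profile
   loses u/2 while its cost is at least c(u)/2, so by AM-GM the density is at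
   least sqrt (c u) |g| there. *)
Lemma level_energy s t u : 0 < u -> s <= t -> u <= psi s -> psi t <= u / 2 ->
  ((u / 2 * Num.sqrt (c u))%:E <=
   \int[mu]_(y in psi @^-1` `](u / 2)%R, u]%classic) (density y)%:E)%E.
Proof.
move=> u0 st us tu; have u2u : u / 2 < u by lra.
have amgm (K G cx : R) : K ^+ 2 / 2 <= cx -> G * K <= 2^-1 * G ^+ 2 + cx.
  by move=> Kcx; have := sqr_ge0 (K - G); rewrite sqrrB; lra.
have [a [b [ab ua bu abx]]] := crossing cpsi st u2u us tu.
set K := Num.sqrt (c u); have K0 : 0 <= K by exact: sqrtr_ge0.
have K2 : K ^+ 2 = c u by rewrite sqr_sqrtr// c_ge0// ltW.
have ig : mu.-integrable `[a, b] (EFin \o g) by exact: locally_integrable_itv.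
have iga : mu.-integrable `[a, b] (EFin \o (fun x => `|g x|)) by exact: integrable_norm.
have drop : u / 2 <= \int[mu]_(y in `[a, b]) `|g y|.
  apply: le_trans (le_normr_Rintegral _ ig) => //.
  rewrite -psiB// distrC (le_trans _ (ler_norm _))//.
  by lra.
have mg : measurable_fun setT g by case: lg.
have mgK D : measurable_fun D (fun x => (`|g x| * K)%:E).
  apply: measurable_funTS; apply/measurable_EFinP; apply: measurable_funM => //.
  exact: measurableT_comp.
have md D : measurable_fun D (fun x => (density x)%:E).
  by apply: measurable_funTS; apply/measurable_EFinP; exact: measurable_density.
have mpre : measurable (psi @^-1` `]u / 2, u]%classic).
  rewrite -[X in measurable X]setTI.
  by apply: (continuous_measurable_fun cpsi) => //; exact: measurable_itv.
apply: (@le_trans _ _ (\int[mu]_(y in `[a, b]) (`|g y| * K)%:E)%E).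
  rewrite -[leRHS]fineK; last first.
    apply: integrable_fin_num => //.
    apply: (@integrable_mul_bounded _ _ (fun y => `|g y|) (cst K) K) => //.
    by move=> x _; rewrite ger0_norm.
  rewrite lee_fin -/(Rintegral mu `[a, b] (fun y => `|g y| * K)).
  by rewrite RintegralZr// ler_wpM2r.
(* [crossing] controls psi only strictly between a and b; the endpoints are negligible. *)
rewrite integral_itv_bndoo//.
apply: (@le_trans _ _ (\int[mu]_(y in `]a, b[) (density y)%:E)%E).
  apply: ge0_le_integral => //.
  - by move=> x _; rewrite lee_fin mulr_ge0.
  - exact: mgK.
  - exact: md.
  move=> x /=; rewrite in_itv/= => /abx /andP[u2x xu]; rewrite lee_fin.
  have x0 : 0 < psi x by rewrite (lt_trans _ u2x)// divr_gt0.
  (* The slope at psi(x) <= u is at least c(u)/u, and psi(x) > u/2. *)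
  have cx : K ^+ 2 / 2 <= c (psi x).
    rewrite K2.
    apply: le_trans (cost_ge_scaled x0 (ltW xu)).
    rewrite -mulrA ler_wpM2l ?c_ge0 ?(ltW u0)//.
    by rewrite ler_pdivlMl// ltW.
  by rewrite /density (gtr0_norm x0); exact: amgm cx.
apply: ge0_subset_integral => //.
- exact: md.
- by move=> x _; rewrite lee_fin density_ge0.
by move=> x /=; rewrite !in_itv/= => /abx /andP[-> /ltW].
Qed.

(** On ]u, 2u] the slope bound gives c(x) <= 2 c(u) <= 4 c(u), so the left side is at most u times 2
    sqrt (c u), which is 4 times the bound of [level_energy]. *)
Lemma sqrt_cost_level s t u : 0 < u -> s <= t -> u <= psi s -> psi t <= u / 2 ->
  (\int[mu]_(x in `]u, (u * 2)%R]) (Num.sqrt (c x))%:E <=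
   4%:E * \int[mu]_(y in psi @^-1` `](u / 2)%R, u]%classic) (density y)%:E)%E.
Proof.
move=> u0 st us tu.
apply: (@le_trans _ _ (4%:E * (u / 2 * Num.sqrt (c u))%:E)%E); last first.
  by rewrite lee_wpmul2l ?lee_fin//; exact: level_energy us tu.
have mI : measurable (`]u, u * 2]%classic : set R) by exact: measurable_itv.
apply: (@le_trans _ _ (\int[mu]_(x in `]u, (u * 2)%R]) cst (2 * Num.sqrt (c u))%:E x)%E).
  apply: ge0_le_integral => //.
  - apply: measurable_sqrt_cost => x /=; rewrite in_itv/= => /andP[ux _].
    exact: ltW (lt_trans u0 ux).
  move=> x /=; rewrite in_itv/= => /andP[ux x2u]; rewrite lee_fin.
  rewrite -(@ler_pXn2r _ 2)// ?nnegrE ?mulr_ge0// exprMn.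
  rewrite !sqr_sqrtr ?c_ge0 ?(ltW u0) ?(ltW (lt_trans u0 ux))//.
  apply: (le_trans (cost_le_scaled u0 (ltW ux))).
  have cu := c_ge0 (ltW u0).
  rewrite mulrAC ler_pdivrMr//.
  apply: (le_trans (ler_wpM2l cu x2u)).
  by rewrite mulrA [_ * 2]mulrC -mulrA ler_wpM2r ?mulr_ge0// ?(ltW u0)// -natrX ler_nat.
rewrite integral_cst//= lebesgue_measure_itv/= lte_fin ltr_pMr// ltr1n.
rewrite -EFinD -!EFinM lee_fin.
by move: (Num.sqrt (c u)) => K; lra.
Qed.

(** The energy spent in band k + 1 pays for the integral over band k. Preimages of disjoint bands
    are disjoint, so the sum over k is at most four times the total energy. *)
Lemma sqrt_cost_integral_near0 s u : 0 < u -> u <= psi s ->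
  (forall d, 0 < d -> exists2 t, s <= t & psi t <= d) ->
  (\int[mu]_y (density y)%:E < +oo)%E ->
  (\int[mu]_(x in `]0%R, u]) (Num.sqrt (c x))%:E < +oo)%E.
Proof.
move=> u0 us small fin.
have md D : measurable_fun D (fun x => (density x)%:E).
  by apply: measurable_funTS; apply/measurable_EFinP; exact: measurable_density.
have d0 y : (0 <= (density y)%:E)%E by rewrite lee_fin density_ge0.
have mI k : measurable (dyadic u k) by exact: measurable_itv.
have mF k : measurable (psi @^-1` dyadic u k.+1).
  rewrite -[X in measurable X]setTI.
  by apply: (continuous_measurable_fun cpsi) => //; exact: measurable_itv.
have tF : trivIset setT (fun k => psi @^-1` dyadic u k.+1).
  move=> i j _ _ [y [yi yj]]; apply/succn_inj.
  by apply: (trivIset_dyadic (ltW u0)) => //; exists (psi y).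
have level k : (\int[mu]_(x in dyadic u k) (Num.sqrt (c x))%:E <=
    4%:E * \int[mu]_(y in psi @^-1` dyadic u k.+1) (density y)%:E)%E.
  (* This level is both the bottom of band k and the top of band k + 1. *)
  pose v := u / 2 ^+ k.+1; have v0 : 0 < v by rewrite divr_gt0// exprn_gt0.
  have [|t st tv] := small (v / 2); first by rewrite divr_gt0.
  have vu : v <= u by have := dyadic_le (ltW u0) (leq0n k.+1); rewrite expr0 divr1.
  have -> : dyadic u k = `]v, v * 2]%classic.
    by rewrite /dyadic /v exprSr invfM mulrA divfK.
  have -> : dyadic u k.+1 = `]v / 2, v]%classic.
    by rewrite /dyadic [in 2 ^+ k.+2]exprSr invfM mulrA.
  exact: sqrt_cost_level v0 st (le_trans vu us) tv.
rewrite -bigcup_dyadic// ge0_integral_bigcup//; last 2 first.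
- apply: measurable_sqrt_cost; rewrite bigcup_dyadic// => x /=.
  by rewrite in_itv/= => /andP[/ltW].
- exact/trivIset_dyadic/ltW.
apply: (@le_lt_trans _ _ (\sum_(0 <= k <oo)
    (4%:E * \int[mu]_(y in psi @^-1` dyadic u k.+1) (density y)%:E))%E).
  apply: lee_nneseries => // k _ _; apply: integral_ge0 => x _.
  by rewrite lee_fin sqrtr_ge0.
rewrite nneseriesZl//; last by move=> k _; exact: integral_ge0.
rewrite -ge0_integral_bigcup//; last exact: md.
apply: (@le_lt_trans _ _ (4%:E * \int[mu]_y (density y)%:E)%E).
  rewrite lee_wpmul2l// ge0_subset_integral//; last exact: md.
  exact: bigcupT_measurable.
by rewrite lte_mul_pinfty.
Qed.

End profile.

(** For u < x <= 1 the slope bound gives c(x) <= (c(u)/u) x <= c(u)/u, so sqrt c is bounded by [M]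
    there. *)
Lemma sqrt_cost_integral_unit u : 0 < u ->
  (\int[mu]_(x in `]0%R, u]) (Num.sqrt (c x))%:E < +oo)%E ->
  (\int[mu]_(x in `[0%R, 1%R]) (Num.sqrt (c x))%:E < +oo)%E.
Proof.
move=> u0 fin; pose M := Num.sqrt (c u / u).
pose f (x : R) := (Num.sqrt (c x))%:E.
pose fu : R -> \bar R := f \_ `]0, u].
have msc (D : set R) : D `<=` [set x | 0 <= x] -> measurable_fun D f.
  exact: measurable_sqrt_cost.
have mu0 : measurable (`]0, u]%classic : set R) by exact: measurable_itv.
have m01 : measurable (`[0, 1]%classic : set R) by exact: measurable_itv.
have f0 x : (0 <= f x)%E by rewrite lee_fin sqrtr_ge0.
have fr0 x : (0 <= fu x)%E by rewrite /fu patchE; case: ifP.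
have mf : measurable_fun setT fu.
  have mfu : measurable_fun `]0, u] f.
    by apply: msc => x /=; rewrite in_itv/= => /andP[/ltW].
  exact: (measurable_restrictT _ mu0).1 mfu.
apply: (@le_lt_trans _ _ (\int[mu]_(x in `[0%R, 1%R]) (fu x + M%:E))%E).
  apply: ge0_le_integral => //.
  - by apply: msc => x /=; rewrite in_itv/= => /andP[].
  - apply: emeasurable_funD => //; exact: measurable_funTS.
  move=> x /=; rewrite in_itv/= => /andP[x0 x1]; rewrite /fu patchE mem_setE in_itv/=.
  have M0 : (0 <= M%:E)%E by rewrite lee_fin sqrtr_ge0.
  (* The point 0 lies outside ]0, u] and is covered by c(0) = 0. *)
  move: x0; rewrite le_eqVlt => /predU1P[<-|x0].
    by rewrite /f c0 sqrtr0 ltxx/= add0e.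
  rewrite x0/=; case: (leP x u) => xu; first exact: leeDl.
  rewrite add0e lee_fin ler_wsqrtr// (le_trans (cost_le_scaled u0 (ltW xu)))//.
  by rewrite ler_piMr// divr_ge0 ?c_ge0// ltW.
rewrite ge0_integralD//; last 2 first.
- exact: measurable_funTS.
- by move=> x _; rewrite lee_fin sqrtr_ge0.
rewrite /fu -integral_mkcondr integral_cst//= lte_add_pinfty//; last first.
  by rewrite lebesgue_measure_itv/= lte_fin ltr01 oppr0 adde0 mule1 ltry.
apply: le_lt_trans fin; apply: ge0_subset_integral => //.
- exact: measurableI.
- by apply: msc => x /=; rewrite in_itv/= => /andP[/ltW].
Qed.

(** If c(y) y^2 >= e near 0, then sqrt (c y) >= sqrt e / x on [x/2, x], so the integral over [0, x]
    is at least sqrt e / 2 for all small x, although it tends to 0. *)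
Lemma liminf_cost_square :
  (\int[mu]_(x in `[0%R, 1%R]) (Num.sqrt (c x))%:E < +oo)%E ->
  limf_einf (fun x : R => (c x / x * x ^+ 3)%:E) (0^'+) = 0%E.
Proof.
move=> fin.
have isc : mu.-integrable `[0, 1] (EFin \o (fun x => Num.sqrt (c x))).
  apply/integrableP; split.
    by apply: measurable_sqrt_cost => x /=; rewrite in_itv/= => /andP[].
  apply: le_lt_trans fin; rewrite le_eqVlt; apply/orP; left; apply/eqP.
  by apply: eq_integral => x _; rewrite /= ger0_norm// sqrtr_ge0.
rewrite limf_einfE; apply/eqP; rewrite eq_le; apply/andP; split; last first.
  (* All values at positive points are nonnegative, so this neighbourhood already gives the lower
     bound 0. *)
  apply: ereal_sup_ge => /=; exists (ereal_inf
    [set (c x / x * x ^+ 3)%:E | x in [set x : R | 0 < x]]).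
    by exists [set x : R | 0 < x] => //; exact: nbhs_right_gt.
  apply: le_ereal_inf_tmp => _ [x /= x0 <-].
  by rewrite lee_fin mulr_ge0 ?exprn_ge0 ?divr_ge0 ?c_ge0 ?ltW.
apply: ub_ereal_sup => _ [V V0 <-]; rewrite leNgt; apply/negP => infV.
have [e e0 eV] : exists2 e, 0 < e & forall x, V x -> e <= c x / x * x ^+ 3.
  have inf_le x : V x -> (ereal_inf [set (c x / x * x ^+ 3)%:E | x in V] <=
      (c x / x * x ^+ 3)%:E)%E.
    by move=> Vx; apply: ereal_inf_lbound; exists x.
  move: infV inf_le; case: (ereal_inf _) => [r|_|//].
    by rewrite lte_fin => r0 rV; exists r => // x /rV; rewrite lee_fin.
  (* An infimum of +oo forces V to be empty, and any e works. *)
  by move=> yV; exists 1 => // x /yV; rewrite leye_eq.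
have e20 : 0 < Num.sqrt e / 2 by rewrite divr_gt0// sqrtr_gt0.
have := parameterized_integral_near_left ltr01 e20 isc.
move=> /nbhs_ballP[d /= d0 dsmall].
move: V0 => /nbhs_ballP[b /= b0 bV].
near (0:R)^'+ => x.
have x0 : 0 < x by near: x; exact: nbhs_right_gt.
have xd : x < d by near: x; exact: nbhs_right_lt.
have xb : x < b by near: x; exact: nbhs_right_lt.
have x1 : x < 1 by near: x; exact: nbhs_right_lt.
have Vx y : 0 < y <= x -> V y.
  move=> /andP[y0 yx]; apply: bV => //.
  by rewrite ball_itv/= in_itv/= sub0r add0r (lt_trans _ y0) ?oppr_lt0//= (le_lt_trans yx).
have : `|\int[mu]_(y in `[0, x]) Num.sqrt (c y)| < Num.sqrt e / 2.
  apply: dsmall; last exact: ltW.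
  by rewrite ball_itv/= in_itv/= sub0r add0r xd (lt_trans _ x0)// oppr_lt0.
rewrite ltNge => /negP; apply; rewrite (le_trans _ (ler_norm _))//.
have i0x : mu.-integrable `[0, x] (EFin \o (fun x => Num.sqrt (c x))).
  apply: (@integrableS _ _ _ mu `[0, 1]) => //.
  by apply: subset_itv; rewrite bnd_simp// ltW.
rewrite -lee_fin fineK; last exact: integrable_fin_num.
apply: (@le_trans _ _ (\int[mu]_(y in `[(x / 2)%R, x]) (Num.sqrt (c y))%:E)%E); last first.
  apply: ge0_subset_integral => //.
  - by case/integrableP : i0x.
  - by apply: subset_itv; rewrite bnd_simp// divr_ge0// ltW.
apply: (@le_trans _ _ (\int[mu]_(y in `[(x / 2)%R, x]) cst (Num.sqrt e / x)%:E y)%E).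
  rewrite integral_cst//= lebesgue_measure_itv/= lte_fin.
  rewrite ifT; last by rewrite ltr_pdivrMr// ltr_pMr// ltr1n.
  rewrite -EFinD -EFinM lee_fin mulrBr divfK ?gt_eqF// mulrA divfK ?gt_eqF//.
  by move: (Num.sqrt e) => K; lra.
apply: ge0_le_integral => //.
- by move=> y _; rewrite lee_fin divr_ge0 ?sqrtr_ge0// ltW.
- apply: measurable_sqrt_cost => y /=; rewrite in_itv/= => /andP[+ _].
  by apply: le_trans; rewrite divr_ge0// ltW.
move=> y /=; rewrite in_itv/= => /andP[xy yx]; rewrite lee_fin.
have y0 : 0 < y by rewrite (lt_le_trans _ xy)// divr_gt0.
have ey : e <= c y * y ^+ 2.
  apply: le_trans (eV _ (Vx y _)) _; first by rewrite y0.
  by rewrite exprS mulrA divfK// gt_eqF.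
rewrite ler_pdivrMr// (@le_trans _ _ (Num.sqrt (c y) * y))//; last first.
  by rewrite ler_wpM2l// sqrtr_ge0.
by rewrite -{2}(ger0_norm (ltW y0)) -sqrtr_sqr -sqrtrM ?c_ge0 ?(ltW y0)// ler_wsqrtr.
Unshelve. all: by end_near. Qed.

End cost.

(** * Consequences of integrability and of positive mass *)

Section integrable_profile.
Context {R : realType}.
Local Notation mu := (@lebesgue_measure R).
Implicit Types f : R -> R.

(** Otherwise |f| exceeds d on a half-line and has infinite integral. *)
Lemma integrable_small_far f s d : mu.-integrable setT (EFin \o f) -> 0 < d ->
  exists2 t, s <= t & f t <= d.
Proof.
move=> /integrableP[mf finf] d0; apply: contrapT => large.
have {}large t : s <= t -> d < f t.
  by move=> st; rewrite ltNge; apply/negP => ftd; apply: large; exists t.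
move: finf; apply/negP; rewrite -leNgt.
have mI : measurable (`[s, +oo[%classic : set R) by exact: measurable_itv.
have mfa D : measurable_fun D (fun x => `|(EFin \o f) x|%E).
  by apply: measurable_funTS; exact: measurableT_comp.
apply: (@le_trans _ _ (\int[mu]_(x in `[s, +oo[) `|(EFin \o f) x|)%E); last first.
  by apply: ge0_subset_integral => //; exact: mfa.
apply: (@le_trans _ _ (\int[mu]_(x in `[s, +oo[) cst d%:E x)%E).
  by rewrite integral_cst//= lebesgue_measure_itv/= ltry addye// gt0_muley ?lte_fin.
apply: ge0_le_integral => //.
- by move=> x _; rewrite lee_fin ltW.
- exact: mfa.
- move=> x /=; rewrite in_itv/= andbT => sx.
  by rewrite lee_fin (le_trans (ltW (large _ sx)))// ler_norm.
Qed.

Lemma Rintegral_gt0_ex f : mu.-integrable setT (EFin \o f) ->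
  0 < \int[mu]_x f x -> exists s, 0 < f s.
Proof.
move=> fi intf; apply: contrapT => neg; move: intf; apply/negP; rewrite -leNgt.
have <- : \int[mu]_(x in setT) (0 : R) = 0 by rewrite Rintegral_cst// mul0r.
apply: le_Rintegral => //; first exact: integrable0.
by move=> x _; rewrite leNgt; apply/negP => fx; apply: neg; exists x.
Qed.

End integrable_profile.

(** * Extraction of a competitor of finite energy *)

Theorem mainTheorem7 (R : realType) (c : R -> R) :
  (forall x, 0 <= x -> 0 <= c x) ->
  c 0 = 0 ->
  (forall x y, 0 < x -> x <= y -> c y / y <= c x / x) ->
  (exists tau : R -> R, admissible tau /\
     forall w, 0 <= w -> induced_cost c w = (tau w)%:E) ->
  (\int[@lebesgue_measure R]_(x in `[0%R, 1%R]) (Num.sqrt (c x))%:E < +oo)%E /\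
  limf_einf (fun x : R => (c x / x * x ^+ 3)%:E) (0^'+) = 0%E.
Proof.
move=> c_ge0 c0 c_slope [tau [_ tauE]].
suff fin : (\int[@lebesgue_measure R]_(x in `[0%R, 1%R]) (Num.sqrt (c x))%:E < +oo)%E.
  by split=> //; exact: liminf_cost_square.
(* Finite cost at mass 1 makes both infima, over profiles and over their weak derivatives, finite;
   each then yields a witness. *)
have : (induced_cost c 1 < +oo)%E by rewrite tauE ?ltry.
move=> /ereal_inf_lt[_ [psi [ipsi psi1] <-]] /ereal_inf_lt[_ [g wd <-] fin].
have [Psi [cPsi psiPsi PsiB]] := weak_derivative_continuous_representative wd.
have [[mpsi _ _] [lg _]] := wd.
have mPsi : measurable_fun setT Psi by exact: continuous_measurable_fun.
have mgx (f : R -> R) : measurable_fun setT f ->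
    measurable_fun setT (fun y => (2^-1 * `|g y| ^+ 2 + c `|f y|)%:E).
  move=> mf; apply/measurable_EFinP; apply: measurable_funD.
    apply: measurable_funM => //; apply: measurable_funX.
    by apply: measurableT_comp => //; case: lg.
  exact: (measurableT_comp (measurable_cost_norm c0 c_slope) mf).
have [N [mN N0 subN]] := psiPsi.
(* A single transfer from psi to [Psi] serves integrability, mass and energy; the energy density
   needs the dependence of F on y through g. *)
have intE (F : R -> R -> \bar R) : measurable_fun setT (fun y => F y (psi y)) ->
    measurable_fun setT (fun y => F y (Psi y)) ->
    (\int[@lebesgue_measure R]_y F y (psi y) =
     \int[@lebesgue_measure R]_y F y (Psi y))%E.
  move=> mF mF'; apply: ae_eq_integral => //.
  exists N; split=> // x /= nx; apply: subN => /= psix; apply: nx => _.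
  by rewrite psix.
have iPsi : (@lebesgue_measure R).-integrable setT (EFin \o Psi).
  apply/integrableP; split; first exact/measurable_EFinP.
  have /integrableP[_] := ipsi.
  have mn (f : R -> R) : measurable_fun setT f ->
      measurable_fun setT (fun y => `|(f y)%:E|%E).
    by move=> mf; apply: measurableT_comp => //; exact/measurable_EFinP.
  by have -> := intE (fun _ r => `|r%:E|%E) (mn _ mpsi) (mn _ mPsi).
have Psi1 : \int[@lebesgue_measure R]_x Psi x = 1.
  rewrite -psi1 /Rintegral; congr fine.
  by rewrite (intE (fun _ r => r%:E))//; exact/measurable_EFinP.
have finPsi : (\int[@lebesgue_measure R]_y
    (2^-1 * `|g y| ^+ 2 + c `|Psi y|)%:E < +oo)%E.
  by have <- := intE (fun y r => (2^-1 * `|g y| ^+ 2 + c `|r|)%:E)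
                     (mgx _ mpsi) (mgx _ mPsi).
(* The positive value [Psi s] itself serves as the starting level u. *)
have [|s Psis] := Rintegral_gt0_ex iPsi; first by rewrite Psi1.
apply: (sqrt_cost_integral_unit c_ge0 c0 c_slope Psis).
apply: (sqrt_cost_integral_near0 c_ge0 c0 c_slope cPsi lg PsiB Psis (lexx _)) => //.
by move=> d d0; exact: integrable_small_far.
Qed.
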